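(* Let $x^{k-1},x^k\in\mathcal W$, $x^k=(\mathbf W_1^k,\dots,\mathbf W_N^k)$, with $x^k\ne x^{k-1}$, let $\kappa>0$ and $y^k:=x^k+\gamma_k(x^k-x^{k-1})$. Let $h$ be the kernel specified in the context. Put $\Delta_k:=x^k-x^{k-1}$, $\Omega_k:=2\|x^k\|^2+2\|\Delta_k\|^2$, $$\mathcal B_k:=\left(\frac{2N-1}{N^{N-1}}\right)\|\Delta_k\|^2\,\Omega_k^{\,N-1},$$ for even $N$ $$\mathcal C_k:=\left(\frac{N-1}{N^{\frac N2-1}}\right)\|\Delta_k\|^2\,\Omega_k^{\frac{N-2}{2}},$$ and for odd $N$ $$\mathcal D_k:=\frac{N}{(N+1)^{\frac{N-1}2}}\|\Delta_k\|^2\,(\Omega_k+1)^{\frac{N-1}2}.$$ Set $\chi(N)=c_1(N)\mathcal B_k+c_2(N)\mathcal C_k$ for $N=2$; $\chi(N)=c_1(N)\mathcal B_k+c_2(N)\mathcal C_k+\rho\|\Delta_k\|^2$ for even $N>2$; and $\chi(N)=c_1(N)\mathcal B_k+c_3(N)\mathcal D_k+\rho\|\Delta_k\|^2$ for odd $N>2$. Then any parameter $\gamma_k$ with $$0<\gamma_k\le\sqrt{\frac{\kappa\,D_h(x^{k-1},x^k)}{\chi(N)}}\le1$$ satisfies the condition $$D_h(x^k,y^k)\le\kappa\,D_h(x^{k-1},x^k).$$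
   Context: Setting: $N\ge2$ is an integer, $d_1,\dots,d_N,d,n_T$ are positive integers, $d_{N+1}:=d$, $\mathcal W_i:=\mathbb R^{d_i\times d_{i+1}}$, $\mathcal W:=\mathcal W_1\times\cdots\times\mathcal W_N$, with elements $\mathbf W=(\mathbf W_1,\dots,\mathbf W_N)$ and norm $\|\mathbf W\|^2=\|\mathbf W\|_F^2:=\sum_{i=1}^N\|\mathbf W_i\|_F^2$. The matrices $\mathbf X\in\mathbb R^{d\times n_T}$, $\mathbf Y\in\mathbb R^{d_1\times n_T}$ are fixed. Constants and kernels: $c_1(N)=\frac{(2N-1)N^N}{2N!}\|\mathbf X\|_F^2$; for even $N$, $c_2(N)=\frac{\|\mathbf Y\|_F\|\mathbf X\|_F(N-1)N^{(N-2)/2}}{(N-2)^{(N-2)/2}}$ (with $0^0=1$ for $N=2$); for odd $N$, $c_3(N)=\frac{\|\mathbf Y\|_F\|\mathbf X\|_F(N-1)(N+1)^{(N-1)/2}}{(N-1)^{(N-1)/2}}$. $H_1(\mathbf W)=\left(\frac{\|\mathbf W\|_F^2}{N}\right)^N$, $H_2(\mathbf W)=\left(\frac{\|\mathbf W\|_F^2}{N}\right)^{N/2}$, $H_3(\mathbf W)=\left(\frac{\|\mathbf W\|_F^2+1}{N+1}\right)^{(N+1)/2}$, $H_4(\mathbf W)=\frac{\|\mathbf W\|_F^2}{N}$. The kernel $h$ is: for $N=2$, $h=c_1(2)H_1+c_2(2)H_2$; for even $N>2$, $h=c_1(N)H_1+c_2(N)H_2+\rho H_4$ with a fixed $\rho>0$;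 for odd $N>2$, $h=c_1(N)H_1+c_3(N)H_3+\rho H_4$ with a fixed $\rho\ge0$. Bregman distance: $D_h(x,y)=h(x)-h(y)-\langle\nabla h(y),x-y\rangle$. *)

(* Defs.v *)
From HB Require Import structures.
From mathcomp Require Import all_boot all_order all_algebra.
From mathcomp Require Import all_classical all_reals all_analysis.
Set Implicit Arguments.
Unset Strict Implicit.
Unset Printing Implicit Defensive.
Import Order.TTheory GRing.Theory Num.Theory.
Import numFieldNormedType.Exports.
Local Open Scope classical_set_scope.
Local Open Scope ring_scope.

(* The space W_1 x ... x W_N, indexed from 0: for i < N, the block [W i] is the
   matrix W_(i+1), the dimension [d i] is d_(i+1), and [d N] is d_(N+1) = d.
   The values of [d] beyond N are irrelevant. *)
Definition params (R : realType) (N : nat) (d : nat -> nat) : Type :=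
  forall i : 'I_N, 'M[R]_(d i, d i.+1).

HB.instance Definition _ R N d := Choice.copy (params R N d)
  (forall i : 'I_N, 'M[R]_(d i, d i.+1)).

Section ParamsLmodule.
Variables (R : realType) (N : nat) (d : nat -> nat).
Local Notation W := (params R N d).
Implicit Types U V : W.

Let zero : W := fun=> 0.
Let opp U : W := fun i => - U i.
Let add U V : W := fun i => U i + V i.
Let scale (a : R) U : W := fun i => a *: U i.

Let addA : associative add.
Proof. by move=> U V T; apply: functional_extensionality_dep => i; exact: addrA. Qed.
Let addC : commutative add.
Proof. by move=> U V; apply: functional_extensionality_dep => i; exact: addrC. Qed.
Let add0 : left_id zero add.
Proof. by move=> U; apply: functional_extensionality_dep => i; exact: add0r. Qed.
Let addN : left_inverse zero opp add.
Proof. by move=> U; apply: functional_extensionality_dep => i; exact: addNr. Qed.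

HB.instance Definition _ := GRing.isZmodule.Build W addA addC add0 addN.

Let scaleA a b U : scale a (scale b U) = scale (a * b) U.
Proof. by apply: functional_extensionality_dep => i; exact: scalerA. Qed.
Let scale1 : left_id 1 scale.
Proof. by move=> U; apply: functional_extensionality_dep => i; exact: scale1r. Qed.
Let scaleDr : right_distributive scale +%R.
Proof. by move=> a U V; apply: functional_extensionality_dep => i; exact: scalerDr. Qed.
Let scaleDl U : {morph scale^~ U : a b / a + b}.
Proof. by move=> a b; apply: functional_extensionality_dep => i; exact: scalerDl. Qed.

HB.instance Definition _ :=
  GRing.Zmodule_isLmodule.Build R W scaleA scale1 scaleDr scaleDl.

End ParamsLmodule.

Definition frob_norm (R : realType) (m n : nat) (A : 'M[R]_(m, n)) : R :=
  Num.sqrt (\sum_i \sum_j A i j ^+ 2).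

Definition pnorm (R : realType) (N : nat) (d : nat -> nat)
    (W : params R N d) : R :=
  Num.sqrt (\sum_i frob_norm (W i) ^+ 2).

Definition pinner (R : realType) (N : nat) (d : nat -> nat)
    (U V : params R N d) : R :=
  \sum_i \sum_a \sum_b U i a b * V i a b.

(* The canonical basis: block [i] is [delta_mx a b], the other blocks are 0. *)
Definition pbasis (R : realType) (N : nat) (d : nat -> nat)
    (i : 'I_N) (a : 'I_(d i)) (b : 'I_(d i.+1)) : params R N d :=
  dfwith (0 : params R N d) i (delta_mx a b).

Definition grad (R : realType) (N : nat) (d : nat -> nat)
    (f : params R N d -> R) (W : params R N d) : params R N d :=
  fun i => \matrix_(a, b) derive1 (fun t : R => f (W + t *: pbasis R a b)) 0.

Definition bregman (R : realType) (N : nat) (d : nat -> nat)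
    (h : params R N d -> R) (x y : params R N d) : R :=
  h x - h y - pinner (grad h y) (x - y).

(* [powR] satisfies 0 `^ 0 = 1, which is the convention needed in [c2] when
   N = 2. The denominator in [c1] is 2 * (N!). *)
Definition c1 (R : realType) (N m n : nat) (X : 'M[R]_(m, n)) : R :=
  (2 * N%:R - 1) * N%:R ^+ N / (2 * (N`!)%:R) * frob_norm X ^+ 2.

Definition c2 (R : realType) (N m n p : nat)
    (X : 'M[R]_(m, n)) (Y : 'M[R]_(p, n)) : R :=
  frob_norm Y * frob_norm X * (N%:R - 1) * N%:R `^ ((N%:R - 2) / 2)
  / (N%:R - 2) `^ ((N%:R - 2) / 2).

Definition c3 (R : realType) (N m n p : nat)
    (X : 'M[R]_(m, n)) (Y : 'M[R]_(p, n)) : R :=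
  frob_norm Y * frob_norm X * (N%:R - 1) * (N%:R + 1) `^ ((N%:R - 1) / 2)
  / (N%:R - 1) `^ ((N%:R - 1) / 2).

Section Kernel.
Variables (R : realType) (N : nat) (d : nat -> nat) (nT : nat).
Variables (X : 'M[R]_(d N, nT)) (Y : 'M[R]_(d 0%N, nT)) (rho : R).
Implicit Types W : params R N d.

Definition H1 W : R := (pnorm W ^+ 2 / N%:R) ^+ N.
Definition H2 W : R := (pnorm W ^+ 2 / N%:R) `^ (N%:R / 2).
Definition H3 W : R := ((pnorm W ^+ 2 + 1) / (N%:R + 1)) `^ ((N%:R + 1) / 2).
Definition H4 W : R := pnorm W ^+ 2 / N%:R.

Definition kernel_h W : R :=
  if N == 2%N then c1 N X * H1 W + c2 N X Y * H2 W
  else if odd N then c1 N X * H1 W + c3 N X Y * H3 W + rho * H4 W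
  else c1 N X * H1 W + c2 N X Y * H2 W + rho * H4 W.

Variables (xprev x : params R N d).

Definition Delta : params R N d := x - xprev.

Definition Omega : R := 2 * pnorm x ^+ 2 + 2 * pnorm Delta ^+ 2.

Definition Bk : R :=
  (2 * N%:R - 1) / N%:R ^+ N.-1 * pnorm Delta ^+ 2 * Omega ^+ N.-1.

Definition Ck : R :=
  (N%:R - 1) / N%:R `^ (N%:R / 2 - 1) * pnorm Delta ^+ 2
  * Omega `^ ((N%:R - 2) / 2).

Definition Dk : R :=
  N%:R / (N%:R + 1) `^ ((N%:R - 1) / 2) * pnorm Delta ^+ 2
  * (Omega + 1) `^ ((N%:R - 1) / 2).

Definition chi : R :=
  if N == 2%N then c1 N X * Bk + c2 N X Y * Ck
  else if odd N then c1 N X * Bk + c3 N X Y * Dk + rho * pnorm Delta ^+ 2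
  else c1 N X * Bk + c2 N X Y * Ck + rho * pnorm Delta ^+ 2.

End Kernel.

(* Main.v *)
Require Import Defs.
From mathcomp Require Import all_boot all_order all_algebra.
From mathcomp Require Import all_classical all_reals all_analysis.
From mathcomp Require Import ring lra.
Import Order.TTheory GRing.Theory Num.Theory.
Local Open Scope ring_scope.

(** Every kernel is a polynomial in the squared norm, because [H2] occurs only
for even [N] and [H3] only for odd [N], so that their exponents are integers.  For
[h = P(|W|^2)] the gradient is [2 P'(|W|^2) W], and polarization of the inner
product turns the Bregman distance into a scalar expression: with [a = |x|^2],
[b = |y|^2] and [delta = |x - y|^2],
  [D_h(x, y) = (P(a) - P(b) - P'(b) (a - b)) + P'(b) delta]
([bregman_radial]).

Take [P(s) = s^p].  The first term is a second-order Taylor remainder, so it is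
at most [p (p - 1) / 2 * M^(p-2) (a - b)^2] when [a, b <= M].  Since
[a - b = <x - y, x + y>] and [|x + y|^2 <= 4 M], Cauchy-Schwarz gives
[(a - b)^2 <= 4 M delta] ([pnorm_sqrB_sqr_le]), hence
  [D_h(x, y) <= p (2 p - 1) M^(p-1) delta]
([bregman_scaled_power_le]).  The constant [p (2 p - 1) M^(p-1)] is half the
largest Hessian eigenvalue of [|W|^(2 p)] on the ball [|W|^2 <= M].

For the extrapolated point [y = x + gamma (x - xprev)] with [gamma <= 1], one has
[delta = gamma^2 |Delta|^2], and both [|x|^2] and [|y|^2] are at most [Omega].
With [p] equal to [N], [N / 2], [(N + 1) / 2] and [1] the bound becomes
[gamma^2] times [Bk], [Ck / 2], [Dk / 2] and [|Delta|^2 / N].  Summing,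
[D_h(x, y) <= gamma^2 chi] ([bregman_kernel_h_le]), and the upper bound on
[gamma] says that [gamma^2 chi <= kappa D_h(xprev, x)]. *)

(** * The Euclidean structure of the parameter space *)

Section InnerProduct.
Context {R : realType} {N : nat} {d : nat -> nat}.
Implicit Types U V W : params R N d.

Lemma pinnerC U V : pinner U V = pinner V U.
Proof.
by apply: eq_bigr => i _; apply: eq_bigr => a _; apply: eq_bigr => b _; exact: mulrC.
Qed.

Lemma pinnerDl U V W : pinner (U + V) W = pinner U W + pinner V W.
Proof.
rewrite -big_split; apply: eq_bigr => i _; rewrite -big_split.
apply: eq_bigr => a _; rewrite -big_split; apply: eq_bigr => b _ /=.
by rewrite [(U + V) i]/(U i + V i) mxE mulrDl.
Qed.

Lemma pinnerZl (k : R) U V : pinner (k *: U) V = k * pinner U V.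
Proof.
rewrite mulr_sumr; apply: eq_bigr => i _; rewrite mulr_sumr.
apply: eq_bigr => a _; rewrite mulr_sumr; apply: eq_bigr => b _ /=.
by rewrite [(k *: U) i]/(k *: U i) mxE mulrA.
Qed.

Lemma pinnerDr U V W : pinner U (V + W) = pinner U V + pinner U W.
Proof. by rewrite pinnerC pinnerDl !(pinnerC U). Qed.

Lemma pinnerZr (k : R) U V : pinner U (k *: V) = k * pinner U V.
Proof. by rewrite pinnerC pinnerZl pinnerC. Qed.

Lemma pnorm_sqr U : pnorm U ^+ 2 = pinner U U.
Proof.
rewrite sqr_sqrtr; last by apply: sumr_ge0 => i _; exact: sqr_ge0.
apply: eq_bigr => i _; rewrite sqr_sqrtr; last first.
  by do 2!apply: sumr_ge0 => ? _; exact: sqr_ge0.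
by apply: eq_bigr => a _; apply: eq_bigr => b _; rewrite expr2.
Qed.

Lemma pnorm_sqrD U V :
  pnorm (U + V) ^+ 2 = pnorm U ^+ 2 + 2 * pinner U V + pnorm V ^+ 2.
Proof. by rewrite !pnorm_sqr pinnerDl !pinnerDr (pinnerC V U); ring. Qed.

Lemma pnorm_sqrZ (k : R) U : pnorm (k *: U) ^+ 2 = k ^+ 2 * pnorm U ^+ 2.
Proof. by rewrite !pnorm_sqr pinnerZl pinnerZr mulrA expr2. Qed.

Lemma pnorm_sqrB U V :
  pnorm (U - V) ^+ 2 = pnorm U ^+ 2 - 2 * pinner U V + pnorm V ^+ 2.
Proof.
by rewrite -scaleN1r pnorm_sqrD pnorm_sqrZ pinnerZr; ring.
Qed.

Lemma pnorm_sqrD_le U V :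
  pnorm (U + V) ^+ 2 <= 2 * pnorm U ^+ 2 + 2 * pnorm V ^+ 2.
Proof.
have := sqr_ge0 (pnorm (U - V)); rewrite pnorm_sqrB pnorm_sqrD; lra.
Qed.

Lemma pinner_pbasis U (i : 'I_N) (a : 'I_(d i)) (b : 'I_(d i.+1)) :
  pinner U (pbasis R a b) = U i a b.
Proof.
rewrite /pinner (bigD1 i) //= (bigD1 a) //= (bigD1 b) //= /pbasis dfwithin.
rewrite mxE !eqxx mulr1 !big1 ?addr0 //.
- move=> j ji; rewrite big1 // => k _; rewrite big1 // => l _.
  by rewrite dfwithout 1?eq_sym // mxE mulr0.
- by move=> k /negPf ka; rewrite big1 // => l _; rewrite mxE ka mulr0.
- by move=> l /negPf lb; rewrite mxE lb andbF mulr0.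
Qed.

Lemma pnorm_pbasis_sqr (i : 'I_N) (a : 'I_(d i)) (b : 'I_(d i.+1)) :
  pnorm (pbasis R a b) ^+ 2 = 1.
Proof. by rewrite pnorm_sqr pinner_pbasis /pbasis dfwithin mxE !eqxx. Qed.

(** * Bregman distances of polynomials in the squared norm *)

Definition radial (P : {poly R}) W : R := P.[pnorm W ^+ 2].

(** Along a basis direction the squared norm is a quadratic polynomial in the
step, so each partial derivative is the formal derivative of a composite
polynomial. *)
Lemma grad_radial P W : grad (radial P) W = (2 * P^`().[pnorm W ^+ 2]) *: W.
Proof.
apply: functional_extensionality_dep => i; apply/matrixP => a b.
rewrite [((_ * _) *: W) i]/(_ *: W i) !mxE.
pose Q := 'X^2 + (2 * W i a b) *: 'X + (pnorm W ^+ 2)%:P.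
have -> : (fun t => radial P (W + t *: pbasis R a b)) = horner (P \Po Q).
  apply: funext => t; rewrite /radial horner_comp pnorm_sqrD pnorm_sqrZ.
  rewrite pnorm_pbasis_sqr pinnerZr pinner_pbasis; congr (P.[_]).
  by rewrite 2!hornerD hornerXn hornerZ hornerX hornerC; ring.
rewrite -derivE deriv_comp hornerM horner_comp /Q !derivD derivXn derivZ derivX derivC.
by rewrite !hornerE expr0n /= add0r; ring.
Qed.

(** Polarization [2 <y, x - y> = |x|^2 - |y|^2 - |x - y|^2] eliminates the inner
product. *)
Lemma bregman_radial P x y :
  bregman (radial P) x y =
  P.[pnorm x ^+ 2] - P.[pnorm y ^+ 2]
  - P^`().[pnorm y ^+ 2] *
    (pnorm x ^+ 2 - pnorm y ^+ 2 - pnorm (x - y) ^+ 2).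
Proof.
rewrite /bregman grad_radial pinnerZl /radial pnorm_sqrB -[- y]scaleN1r.
by rewrite pinnerDr pinnerZr (pinnerC y x) -!pnorm_sqr; ring.
Qed.

Lemma radialD P Q : (fun W => radial P W + radial Q W) = radial (P + Q).
Proof. by apply: funext => W; rewrite /radial hornerD. Qed.

Lemma radialZ (k : R) P : (fun W => k * radial P W) = radial (k *: P).
Proof. by apply: funext => W; rewrite /radial hornerZ. Qed.

(** Additivity of the Bregman distance needs differentiability; being a
polynomial in the squared norm is a convenient sufficient condition. *)
Definition is_radial (f : params R N d -> R) : Prop :=
  exists P : {poly R}, f = radial P.

Lemma is_radialD f g :
  is_radial f -> is_radial g -> is_radial (fun W => f W + g W).
Proof. by move=> [P ->] [Q ->]; exists (P + Q); exact: radialD. Qed.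

Lemma is_radialZ (k : R) f : is_radial f -> is_radial (fun W => k * f W).
Proof. by move=> [P ->]; exists (k *: P); exact: radialZ. Qed.

Lemma bregmanD f g x y : is_radial f -> is_radial g ->
  bregman (fun W => f W + g W) x y = bregman f x y + bregman g x y.
Proof.
move=> [P ->] [Q ->].
by rewrite radialD !bregman_radial derivD !hornerD; ring.
Qed.

Lemma bregmanZ (k : R) f x y : is_radial f ->
  bregman (fun W => k * f W) x y = k * bregman f x y.
Proof.
move=> [P ->].
by rewrite radialZ !bregman_radial derivZ !hornerZ; ring.
Qed.

(** Cauchy-Schwarz for [|x|^2 - |y|^2 = <x - y, x + y>], where
[|x + y|^2 <= 2 |x|^2 + 2 |y|^2 <= 4 M]. *)
Lemma pnorm_sqrB_sqr_le (x y : params R N d) (M : R) :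
  pnorm x ^+ 2 <= M -> pnorm y ^+ 2 <= M ->
  (pnorm x ^+ 2 - pnorm y ^+ 2) ^+ 2 <= 4 * M * pnorm (x - y) ^+ 2.
Proof.
move=> xM yM; have := sqr_ge0 (pnorm x); have := sqr_ge0 (pnorm y).
set c := _ - _ => y0 x0; have M0 : 0 <= M by exact: le_trans xM.
have cE : c = pinner (x - y) (x + y).
  by rewrite -[- y]scaleN1r pinnerDl !pinnerDr !pinnerZl (pinnerC y x)
    -!pnorm_sqr /c; ring.
have [M_gt0|M_le0] := ltP 0 M; last first.
  have -> : c = 0 by rewrite /c; lra.
  by rewrite expr0n /= mulr_ge0 ?sqr_ge0 // mulr_ge0.
(* The bound [4 M] in place of [|x + y|^2] in the usual discriminant argument
   keeps the divisor positive even if [x + y = 0]. *)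
have := sqr_ge0 (pnorm ((4 * M) *: (x - y) - c *: (x + y))).
rewrite (pnorm_sqrB (_ *: _)) !pnorm_sqrZ pinnerZl pinnerZr -cE.
have : pnorm (x + y) ^+ 2 <= 4 * M.
  by apply: le_trans (pnorm_sqrD_le x y) _; lra.
move: (pnorm (x + y) ^+ 2) (pnorm (x - y) ^+ 2) => u v uM H.
have M4_gt0 : 0 < 4 * M by lra.
rewrite -(ler_pM2l M4_gt0); have := ler_wpM2l (sqr_ge0 c) uM; lra.
Qed.


End InnerProduct.

(** * Powers of the squared norm *)

(** The remainders [E_n = a^n - b^n - n b^(n-1) (a - b)] satisfy
[E_(n+1) = a E_n + n b^(n-1) (a - b)^2], which gives the bound
[n (n - 1) / 2 * M^(n-2) (a - b)^2] by induction.  Trading [(a - b)^2] for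
[4 M delta] beforehand leaves a single power of [M]. *)
Lemma power_remainder_le {R : realFieldType} (a b M delta : R) (p : nat) :
  0 <= a -> a <= M -> 0 <= b -> b <= M -> 0 <= delta ->
  (a - b) ^+ 2 <= 4 * M * delta ->
  a ^+ p.+1 - b ^+ p.+1 - p.+1%:R * b ^+ p * (a - b)
  <= 2 * p.+1%:R * p%:R * M ^+ p * delta.
Proof.
move=> a0 aM b0 bM delta0 abM; have M0 : 0 <= M by exact: le_trans aM.
elim: p => [|p IHp].
  by rewrite !expr0 !expr1; lra.
have -> : a ^+ p.+2 - b ^+ p.+2 - p.+2%:R * b ^+ p.+1 * (a - b) =
    a * (a ^+ p.+1 - b ^+ p.+1 - p.+1%:R * b ^+ p * (a - b))
    + p.+1%:R * b ^+ p * (a - b) ^+ 2.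
  by rewrite !exprS !mulrS; ring.
have -> : 2 * p.+2%:R * p.+1%:R * M ^+ p.+1 * delta =
    M * (2 * p.+1%:R * p%:R * M ^+ p * delta)
    + p.+1%:R * M ^+ p * (4 * M * delta).
  by rewrite !exprS !mulrS; ring.
apply: lerD.
  apply: le_trans (ler_wpM2l a0 IHp) _; apply: ler_wpM2r aM.
  by rewrite !mulr_ge0 ?exprn_ge0.
apply: ler_pM => //; rewrite ?sqr_ge0 ?mulr_ge0 ?exprn_ge0 //.
by apply: ler_wpM2l => //; exact: lerXn2r.
Qed.

Section ScaledPower.
Context {R : realType} {N : nat} {d : nat -> nat}.
Implicit Types x y W : params R N d.

(** The common shape of [H1], ..., [H4]. *)
Definition scaled_power (e c : R) (n : nat) W : R :=
  ((pnorm W ^+ 2 + e) / c) ^+ n.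

Lemma scaled_powerE e c n :
  scaled_power e c n = radial (c ^- n *: ('X + e%:P) ^+ n).
Proof.
apply: funext => W; rewrite /scaled_power /radial hornerZ horner_exp hornerD.
by rewrite hornerX hornerC expr_div_n mulrC.
Qed.

Lemma scaled_power_radial e c n : is_radial (scaled_power e c n).
Proof. by eexists; exact: scaled_powerE. Qed.

(** Here [n = p + 1], so [(p + 1) (2 p + 1)] is [n (2 n - 1)]: the Taylor remainder
contributes [2 n (n - 1)] and the term [P'(b) delta] contributes [n]. *)
Lemma bregman_scaled_power_le (e c M : R) (p : nat) x y :
  0 <= e -> 0 < c -> pnorm x ^+ 2 + e <= M -> pnorm y ^+ 2 + e <= M ->
  bregman (scaled_power e c p.+1) x y
  <= p.+1%:R * (2 * p%:R + 1) / c ^+ p.+1 * M ^+ p * pnorm (x - y) ^+ 2.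
Proof.
move=> e0 c0 xM yM.
have abM : (pnorm x ^+ 2 - pnorm y ^+ 2) ^+ 2 <= 4 * M * pnorm (x - y) ^+ 2.
  by apply: pnorm_sqrB_sqr_le; lra.
rewrite scaled_powerE bregman_radial derivZ deriv_exp derivD derivX derivC.
rewrite addr0 ?mul1r ?mulr1 !hornerZ hornerMn !horner_exp !hornerD !hornerX !hornerC.
move: (sqr_ge0 (pnorm x)) (sqr_ge0 (pnorm y)) (sqr_ge0 (pnorm (x - y))).
move: (pnorm x ^+ 2) (pnorm y ^+ 2) (pnorm (x - y) ^+ 2) xM yM abM.
move=> a b delta aM bM abM a0 b0 delta0.
have abeM : ((a + e) - (b + e)) ^+ 2 <= 4 * M * delta.
  by rewrite (_ : a + e - (b + e) = a - b) //; ring.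
have := power_remainder_le _ _ _ _ p (addr_ge0 a0 e0) aM (addr_ge0 b0 e0) bM
  delta0 abeM.
have : (b + e) ^+ p <= M ^+ p by rewrite lerXn2r ?nnegrE //; lra.
set Mp := M ^+ p; set bp := (b + e) ^+ p => bpM rem.
have ci0 : 0 <= c ^- p.+1 by rewrite invr_ge0 exprn_ge0 // ltW.
have le1 : p.+1%:R * delta * bp <= p.+1%:R * delta * Mp.
  by rewrite ler_wpM2l // mulr_ge0.
set lhs := (X in X <= _).
have -> : lhs = c ^- p.+1 * ((a + e) ^+ p.+1 - (b + e) ^+ p.+1
    - p.+1%:R * bp * (a + e - (b + e)) + p.+1%:R * delta * bp).
  by rewrite /lhs /bp -mulr_natl; ring.
have -> : p.+1%:R * (2 * p%:R + 1) / c ^+ p.+1 * Mp * delta =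
    c ^- p.+1 * (2 * p.+1%:R * p%:R * Mp * delta + p.+1%:R * delta * Mp).
  by ring.
by apply: ler_wpM2l => //; exact: lerD.
Qed.

(** [Omega] dominates the squared norms of both [x] and the extrapolated point
because [gamma <= 1]. *)
Lemma bregman_scaled_power_extrapolation_le (e c gamma : R) (p : nat) xprev x :
  0 <= e -> 0 < c -> 0 <= gamma <= 1 ->
  bregman (scaled_power e c p.+1) x (x + gamma *: (x - xprev))
  <= gamma ^+ 2 * (p.+1%:R * (2 * p%:R + 1) / c ^+ p.+1
       * pnorm (Delta xprev x) ^+ 2 * (Omega xprev x + e) ^+ p).
Proof.
move=> e0 c0 /andP[gamma0 gamma1].
rewrite -/(Delta xprev x) /Omega; set D := Delta xprev x.
have gamma2 : gamma ^+ 2 <= 1 by rewrite expr_le1.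
have gD : gamma ^+ 2 * pnorm D ^+ 2 <= pnorm D ^+ 2.
  by rewrite ler_piMl // sqr_ge0.
have x0 := sqr_ge0 (pnorm x); have D0 := sqr_ge0 (pnorm D).
apply: le_trans (@bregman_scaled_power_le e c
  (2 * pnorm x ^+ 2 + 2 * pnorm D ^+ 2 + e) p x _ e0 c0 _ _) _.
- by lra.
- by have := pnorm_sqrD_le x (gamma *: D); rewrite pnorm_sqrZ; lra.
- rewrite opprD addrA subrr add0r -scaleNr pnorm_sqrZ sqrrN.
  by rewrite le_eqVlt; apply/orP; left; apply/eqP; ring.
Qed.

End ScaledPower.

(** * The four kernels *)

Section Kernel.
Context {R : realType} {N : nat} {d : nat -> nat}.
Variables (gamma : R) (xprev x : params R N d).

Lemma H1_scaled_power : (0 < N)%N ->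
  @H1 R N d = scaled_power 0 N%:R N.-1.+1.
Proof.
by move=> N0; apply: funext => W; rewrite /scaled_power addr0 prednK.
Qed.

Lemma H2_scaled_power k : N = k.*2 -> @H2 R N d = scaled_power 0 N%:R k.
Proof.
move=> hk; apply: funext => W; rewrite /scaled_power addr0 -powR_mulrn.
  by rewrite /H2 [in X in _ `^ X]hk -muln2 natrM mulfK.
by rewrite divr_ge0 ?sqr_ge0.
Qed.

Lemma H3_scaled_power k :
  N.+1 = k.*2 -> @H3 R N d = scaled_power 1 (N%:R + 1) k.
Proof.
move=> hk; apply: funext => W; rewrite /scaled_power -powR_mulrn.
  by rewrite /H3 [in X in _ `^ X]natr1 hk -muln2 natrM mulfK.
by rewrite divr_ge0 ?addr_ge0 ?sqr_ge0.
Qed.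

Lemma H4_scaled_power : @H4 R N d = scaled_power 0 N%:R 1.
Proof. by apply: funext => W; rewrite /scaled_power addr0 expr1. Qed.

Lemma Omega_ge0 : 0 <= Omega xprev x.
Proof. by rewrite addr_ge0 // mulr_ge0 // sqr_ge0. Qed.

Lemma Bk_ge0 : (0 < N)%N -> 0 <= Bk xprev x.
Proof.
move=> N0; have N1 : 1 <= N%:R :> R by rewrite ler1n.
rewrite /Bk mulr_ge0 ?exprn_ge0 ?Omega_ge0 // mulr_ge0 ?sqr_ge0 //.
by rewrite divr_ge0 ?exprn_ge0 //; lra.
Qed.

Lemma Ck_ge0 : (0 < N)%N -> 0 <= Ck xprev x.
Proof.
move=> N0; have N1 : 1 <= N%:R :> R by rewrite ler1n.
rewrite /Ck mulr_ge0 ?powR_ge0 // mulr_ge0 ?sqr_ge0 //.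
by rewrite divr_ge0 ?powR_ge0 //; lra.
Qed.

Lemma Dk_ge0 : 0 <= Dk xprev x.
Proof.
rewrite /Dk mulr_ge0 ?powR_ge0 // mulr_ge0 ?sqr_ge0 //.
Qed.

Hypothesis gamma01 : 0 <= gamma <= 1.
Let y : params R N d := x + gamma *: (x - xprev).

Lemma bregman_H1_le : (0 < N)%N ->
  bregman (@H1 R N d) x y <= gamma ^+ 2 * Bk xprev x.
Proof.
move=> N0; have NR0 : 0 < N%:R :> R by rewrite ltr0n.
rewrite H1_scaled_power //.
apply: le_trans
  (bregman_scaled_power_extrapolation_le _ _ _ _ _ _ (lexx 0) NR0 gamma01) _.
have nE : N.-1.+1%:R = N%:R :> R by rewrite prednK.
have -> : N.-1%:R = N%:R - 1 :> R by rewrite -nE -natr1 addrK.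
rewrite addr0 /Bk nE (exprS N%:R) le_eqVlt; apply/orP; left; apply/eqP.
field.
by rewrite ?expf_neq0 gt_eqF.
Qed.

(** The general constant is [(N / 2) (N - 1) / N^(N / 2)], half of that in [Ck]. *)
Lemma bregman_H2_le q : N = q.+1.*2 ->
  bregman (@H2 R N d) x y <= gamma ^+ 2 * Ck xprev x.
Proof.
move=> hq; have NE : N%:R = 2 * q%:R + 2 :> R.
  by rewrite hq -muln2 natrM -natr1; ring.
have NR0 : 0 < N%:R :> R by rewrite NE; have := ler0n R q; lra.
have N0 : (0 < N)%N by rewrite -(ltr0n R).
have CE : Ck xprev x = (N%:R - 1) / N%:R ^+ q * pnorm (Delta xprev x) ^+ 2
    * Omega xprev x ^+ q.
  rewrite /Ck (_ : N%:R / 2 - 1 = q%:R); last by rewrite NE; field.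
  rewrite (_ : (N%:R - 2) / 2 = q%:R); last by rewrite NE; field.
  by rewrite !powR_mulrn ?Omega_ge0 ?ltW.
rewrite (H2_scaled_power _ hq).
apply: le_trans
  (bregman_scaled_power_extrapolation_le _ _ _ _ _ _ (lexx 0) NR0 gamma01) _.
rewrite ler_wpM2l ?sqr_ge0 // addr0.
suff -> : q.+1%:R * (2 * q%:R + 1) / N%:R ^+ q.+1
    * pnorm (Delta xprev x) ^+ 2 * Omega xprev x ^+ q = Ck xprev x / 2.
  by have := Ck_ge0 N0; lra.
have -> : q.+1%:R = N%:R / 2 :> R by rewrite NE -natr1; field.
have -> : 2 * q%:R + 1 = N%:R - 1 :> R by rewrite NE; ring.
by rewrite CE exprS; field; rewrite ?expf_neq0 gt_eqF.
Qed.

(** The general constant is [((N + 1) / 2) N / (N + 1)^((N + 1) / 2)], half of that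
in [Dk]. *)
Lemma bregman_H3_le q : N.+1 = q.+1.*2 ->
  bregman (@H3 R N d) x y <= gamma ^+ 2 * Dk xprev x.
Proof.
move=> hq; have NE : N%:R = 2 * q%:R + 1 :> R.
  by apply: (addIr 1); rewrite natr1 hq -muln2 natrM -natr1; ring.
have NR0 : 0 < N%:R + 1 :> R by rewrite ltr_wpDl.
have DE : Dk xprev x = N%:R / (N%:R + 1) ^+ q * pnorm (Delta xprev x) ^+ 2
    * (Omega xprev x + 1) ^+ q.
  rewrite /Dk (_ : (N%:R - 1) / 2 = q%:R); last by rewrite NE; field.
  by rewrite !powR_mulrn // addr_ge0 ?Omega_ge0.
rewrite (H3_scaled_power _ hq).
apply: le_trans
  (bregman_scaled_power_extrapolation_le _ _ _ _ _ _ ler01 NR0 gamma01) _.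
rewrite ler_wpM2l ?sqr_ge0 //.
suff -> : q.+1%:R * (2 * q%:R + 1) / (N%:R + 1) ^+ q.+1
    * pnorm (Delta xprev x) ^+ 2 * (Omega xprev x + 1) ^+ q = Dk xprev x / 2.
  by have := Dk_ge0; lra.
have -> : q.+1%:R = (N%:R + 1) / 2 :> R by rewrite NE -natr1; field.
by rewrite -NE DE exprS; field; rewrite ?expf_neq0 gt_eqF.
Qed.

Lemma bregman_H4_le : (0 < N)%N ->
  bregman (@H4 R N d) x y <= gamma ^+ 2 * pnorm (Delta xprev x) ^+ 2.
Proof.
move=> N0; have N1 : 1 <= N%:R :> R by rewrite ler1n.
have NR0 : 0 < N%:R :> R by rewrite ltr0n.
rewrite H4_scaled_power.
apply: le_trans
  (bregman_scaled_power_extrapolation_le _ _ _ _ _ _ (lexx 0) NR0 gamma01) _.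
rewrite ler_wpM2l ?sqr_ge0 // expr0 expr1 mulr0 add0r mul1r mulr1.
by rewrite ler_piMl ?sqr_ge0 // mul1r invf_le1.
Qed.

End Kernel.

(** * The composite kernel *)

Lemma c1_ge0 (R : realType) (N m n : nat) (X : 'M[R]_(m, n)) :
  (0 < N)%N -> 0 <= c1 N X.
Proof.
move=> N0; have N1 : 1 <= N%:R :> R by rewrite ler1n.
rewrite /c1 mulr_ge0 ?sqr_ge0 // divr_ge0 ?mulr_ge0 ?exprn_ge0 //; lra.
Qed.

Lemma c2_ge0 (R : realType) (N m n p : nat)
  (X : 'M[R]_(m, n)) (Y : 'M[R]_(p, n)) : (0 < N)%N -> 0 <= c2 N X Y.
Proof.
move=> N0; have N1 : 0 <= N%:R - 1 :> R by rewrite subr_ge0 ler1n.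
by rewrite /c2 divr_ge0 ?powR_ge0 // !mulr_ge0 ?powR_ge0 ?sqrtr_ge0.
Qed.

Lemma c3_ge0 (R : realType) (N m n p : nat)
  (X : 'M[R]_(m, n)) (Y : 'M[R]_(p, n)) : (0 < N)%N -> 0 <= c3 N X Y.
Proof.
move=> N0; have N1 : 0 <= N%:R - 1 :> R by rewrite subr_ge0 ler1n.
by rewrite /c3 divr_ge0 ?powR_ge0 // !mulr_ge0 ?powR_ge0 ?sqrtr_ge0.
Qed.

Section Chi.
Context {R : realType} {N : nat} {d : nat -> nat} {nT : nat}.
Variables (X : 'M[R]_(d N, nT)) (Y : 'M[R]_(d 0%N, nT)) (rho : R).
Variables (xprev x : params R N d).
Hypothesis (hN : (2 <= N)%N) (hrho : N != 2%N -> 0 <= rho).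

Let N_gt0 : (0 < N)%N. Proof. exact: leq_trans hN. Qed.

Lemma chi_ge0 : 0 <= chi X Y rho xprev x.
Proof.
have c10 := c1_ge0 _ N _ _ X N_gt0.
have c20 := c2_ge0 _ N _ _ _ X Y N_gt0.
have c30 := c3_ge0 _ N _ _ _ X Y N_gt0.
have B0 := Bk_ge0 xprev x N_gt0; have C0 := Ck_ge0 xprev x N_gt0.
have D0 := Dk_ge0 xprev x; have Delta0 := sqr_ge0 (pnorm (Delta xprev x)).
rewrite /chi; case: eqVneq => [_|/hrho rho0]; last case: ifP => _;
  by rewrite ?addr_ge0 // mulr_ge0.
Qed.

Lemma bregman_kernel_h_le (gamma : R) : 0 <= gamma <= 1 ->
  bregman (kernel_h X Y rho) x (x + gamma *: (x - xprev))
  <= gamma ^+ 2 * chi X Y rho xprev x.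
Proof.
move=> gamma01; set y := x + _.
have c10 := c1_ge0 _ N _ _ X N_gt0.
have c20 := c2_ge0 _ N _ _ _ X Y N_gt0.
have c30 := c3_ge0 _ N _ _ _ X Y N_gt0.
have rad1 : is_radial (@H1 R N d).
  by rewrite H1_scaled_power //; exact: scaled_power_radial.
have rad4 : is_radial (@H4 R N d).
  by rewrite H4_scaled_power; exact: scaled_power_radial.
have le1 := ler_wpM2l c10 (bregman_H1_le gamma xprev x gamma01 N_gt0).
have le4 := bregman_H4_le gamma xprev x gamma01 N_gt0.
have even_case : ~~ odd N ->
    is_radial (fun W : params R N d => c1 N X * H1 W + c2 N X Y * H2 W)
    /\ bregman (fun W : params R N d => c1 N X * H1 W + c2 N X Y * H2 W) x y
       <= gamma ^+ 2 * (c1 N X * Bk xprev x + c2 N X Y * Ck xprev x).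
  move=> evenN; have hk : N = (N./2.-1).+1.*2.
    by rewrite prednK ?half_gt0 // even_halfK.
  have rad2 : is_radial (@H2 R N d).
    by rewrite (H2_scaled_power _ hk); exact: scaled_power_radial.
  have rc1 := is_radialZ (c1 N X) _ rad1.
  have rc2 := is_radialZ (c2 N X Y) _ rad2.
  split; first exact: is_radialD.
  rewrite bregmanD // !bregmanZ //.
  have le2 := ler_wpM2l c20 (bregman_H2_le gamma xprev x gamma01 _ hk).
  rewrite (mulrDr (gamma ^+ 2)) (mulrCA (gamma ^+ 2) (c1 N X))
    (mulrCA (gamma ^+ 2) (c2 N X Y)).
  exact: lerD.
have odd_case : odd N ->
    is_radial (fun W : params R N d => c1 N X * H1 W + c3 N X Y * H3 W)
    /\ bregman (fun W : params R N d => c1 N X * H1 W + c3 N X Y * H3 W) x y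
       <= gamma ^+ 2 * (c1 N X * Bk xprev x + c3 N X Y * Dk xprev x).
  move=> oddN; have hk : N.+1 = (N./2).+1.*2.
    by rewrite doubleS odd_halfK // prednK.
  have rad3 : is_radial (@H3 R N d).
    by rewrite (H3_scaled_power _ hk); exact: scaled_power_radial.
  have rc1 := is_radialZ (c1 N X) _ rad1.
  have rc3 := is_radialZ (c3 N X Y) _ rad3.
  split; first exact: is_radialD.
  rewrite bregmanD // !bregmanZ //.
  have le3 := ler_wpM2l c30 (bregman_H3_le gamma xprev x gamma01 _ hk).
  rewrite (mulrDr (gamma ^+ 2)) (mulrCA (gamma ^+ 2) (c1 N X))
    (mulrCA (gamma ^+ 2) (c3 N X Y)).
  exact: lerD.
have add_H4 (f : params R N d -> R) (K : R) : N != 2%N ->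
    is_radial f /\ bregman f x y <= gamma ^+ 2 * K ->
    bregman (fun W : params R N d => f W + rho * H4 W) x y
    <= gamma ^+ 2 * (K + rho * pnorm (Delta xprev x) ^+ 2).
  move=> /hrho rho0 [radf lef]; have rc4 := is_radialZ rho _ rad4.
  rewrite bregmanD // bregmanZ // (mulrDr (gamma ^+ 2)) (mulrCA _ rho).
  by apply: lerD => //; exact: ler_wpM2l.
rewrite /kernel_h /chi; have [N2|Nneq2] := eqVneq N 2%N.
  by case: even_case => //; rewrite N2.
by case: ifPn => oddN; apply: add_H4 => //; [exact: odd_case|exact: even_case].
Qed.
End Chi.

Theorem proposition11 (R : realType) (N : nat) (d : nat -> nat) (nT : nat)
    (X : 'M[R]_(d N, nT)) (Y : 'M[R]_(d 0%N, nT))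
    (rho kappa gamma : R) (xprev x : params R N d)
    (hN : (2 <= N)%N)
    (hd : forall i : nat, (i <= N)%N -> (0 < d i)%N)
    (hnT : (0 < nT)%N)
    (hrho_even : (2 < N)%N -> ~~ odd N -> 0 < rho)
    (hrho_odd : odd N -> 0 <= rho)
    (hx : x <> xprev)
    (hkappa : 0 < kappa) :
  let h : params R N d -> R := kernel_h X Y rho in
  let y : params R N d := x + gamma *: (x - xprev) in
  let bound : R :=
    Num.sqrt (kappa * bregman h xprev x / chi X Y rho xprev x) in
  0 < gamma -> gamma <= bound -> bound <= 1 ->
  bregman h x y <= kappa * bregman h xprev x.
Proof.
move=> h y bound gamma_gt0 gamma_bound bound1.
have hrho : N != 2%N -> 0 <= rho.
  move=> N2; have [/hrho_odd //|evenN] := boolP (odd N).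
  by apply/ltW/hrho_even; rewrite // ltn_neqAle eq_sym N2.
have gamma01 : 0 <= gamma <= 1.
  by rewrite ltW //=; exact: le_trans bound1.
apply: le_trans (bregman_kernel_h_le X Y rho xprev x hN hrho gamma gamma01) _.
have bound_gt0 : 0 < bound by exact: lt_le_trans gamma_bound.
have ratio_gt0 : 0 < kappa * bregman h xprev x / chi X Y rho xprev x.
  by rewrite -sqrtr_gt0.
(* Division by zero is zero, so a vanishing [chi] would force [bound = 0]. *)
have chi_gt0 : 0 < chi X Y rho xprev x.
  rewrite lt_def chi_ge0 // andbT; apply: contraTneq ratio_gt0 => ->.
  by rewrite invr0 mulr0 ltxx.
rewrite -ler_pdivlMr // -(sqr_sqrtr (ltW ratio_gt0)).
by rewrite lerXn2r ?nnegrE ?sqrtr_ge0 // ltW.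
Qed.
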